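(* Let $(V,\Omega)$ be a symplectic vector space with canonical Liouville form $\theta$, given by $\theta_z(v_z)=\frac12\Omega(z,v)$ for $z,v\in V$. Let $n$ be a positive integer, let $a\in V$, let $\psi^a:V\to\mathbb{R}$ be $\psi^a(z)=\frac{1}{2(n+2)}\Omega(a,z)^{n+2}$, and let $\theta^a=\theta+{\rm d}\psi^a$. Then $${\rm Aut}(V,\theta^a)=\{f_a\circ\gamma\circ f_a^{-1}:\gamma\in{\rm Sp}(V,\Omega)\},$$ where $f_a:V\to V$ is the diffeomorphism $f_a(z)=z+\frac1n\Omega(a,z)^{n+1}a$.
   Context: A symplectic vector space $(V,\Omega)$ is a finite-dimensional real vector space $V$ with a nonsingular alternating bilinear form $\Omega$. Regard $V$ as a smooth manifold; for $z,v\in V$ let $v_z\in T_zV$ be the tangent vector given by $v_z\psi=\frac{\rm d}{{\rm d}t}\psi(z+tv)|_{t=0}$ for smooth $\psi:V\to\mathbb{R}$. ${\rm Sp}(V,\Omega)$ is the group of linear automorphisms $g$ of $V$ with $\Omega(gx,gy)=\Omega(x,y)$ for all $x,y\in V$. For a one-form $\alpha$ on $V$, ${\rm Aut}(V,\alpha)$ is the group of all diffeomorphisms $g:V\to V$ with $g^*\alpha=\alpha$. The inverse of $f_a$ is $z\mapsto z-\frac1n\Omega(a,z)^{n+1}a$. *)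

(* Defs.v *)
From HB Require Import structures.
From mathcomp Require Import all_boot all_order all_algebra.
From mathcomp Require Import all_classical all_reals all_analysis.

Set Implicit Arguments.
Unset Strict Implicit.
Unset Printing Implicit Defensive.

Import Order.TTheory GRing.Theory Num.Theory.
Import numFieldNormedType.Exports.

Local Open Scope classical_set_scope.
Local Open Scope ring_scope.

(* A [vectType] carries no topology: its smooth structure is the one given by *)
(* the global chart V -> R^(dim V) of coordinates in a basis. Two bases give  *)
(* charts differing by a linear automorphism of R^(dim V), so the choice of   *)
(* [vbasis] has no effect on the notions below.                               *)
Section Smooth.
Variable R : realType.

Definition chart (V : vectType R) : V -> 'rV[R]_(\dim {:V}) :=
  passmx.rVof (vbasis {:V}).

Definition unchart (V : vectType R) : 'rV[R]_(\dim {:V}) -> V :=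
  passmx.vecof (vbasis {:V}).

Fixpoint Ck (p q k : nat) (f : 'rV[R]_p -> 'rV[R]_q) : Prop :=
  match k with
  | 0%N => continuous f
  | k'.+1 => (forall x, differentiable f x) /\
             (forall v, Ck k' (fun x => 'D_v f x))
  end.

Definition smooth (V W : vectType R) (g : V -> W) : Prop :=
  forall k : nat, Ck k (@chart W \o g \o @unchart V).

Definition diffeomorphism (V : vectType R) (g : V -> V) : Prop :=
  smooth g /\ exists h : V -> V, [/\ cancel g h, cancel h g & smooth h].

End Smooth.

Section OneForms.
Variables (R : realType) (V : vectType R).

(* v_z psi, the action of the tangent vector v_z on the function psi *)
Definition tangent (z v : V) (psi : V -> R) : R :=
  derive1 (fun t : R => psi (z + t *: v)) 0.

(* A one-form alpha is given by (z, v) |-> alpha_z(v_z). *)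
Definition one_form : Type := V -> V -> R.

Definition extd (psi : V -> R) : one_form := fun z v => tangent z v psi.

(* the w such that the tangent map of g sends v_z to w_(g z); the derivative  *)
(* of the curve t |-> g (z + t v) is computed in the chart                    *)
Definition tangent_map (g : V -> V) (z v : V) : V :=
  unchart (derive1 (fun t : R => chart (g (z + t *: v))) 0).

Definition pullback (g : V -> V) (alpha : one_form) : one_form :=
  fun z v => alpha (g z) (tangent_map g z v).

Definition Aut (alpha : one_form) : set (V -> V) :=
  [set g | diffeomorphism g /\ pullback g alpha = alpha].

End OneForms.

Section Symplectic.
Variables (R : realType) (V : vectType R) (Omega : {biscalar V}).

Definition symplectic : Prop :=
  (forall x, Omega x x = 0) /\
  (forall x, (forall y, Omega x y = 0) -> x = 0).

Definition Sp : set (V -> V) :=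
  [set g | [/\ linear g, bijective g &
               forall x y, Omega (g x) (g y) = Omega x y]].

Definition liouville : one_form V := fun z v => 2^-1 * Omega z v.

Variables (n : nat) (a : V).

Definition psi_a (z : V) : R := (2 * n.+2%:R)^-1 * Omega a z ^+ n.+2.

Definition theta_a : one_form V :=
  fun z v => liouville z v + extd psi_a z v.

Definition f_a (z : V) : V := z + (n%:R^-1 * Omega a z ^+ n.+1) *: a.

Definition f_a_inv (z : V) : V := z - (n%:R^-1 * Omega a z ^+ n.+1) *: a.

End Symplectic.

(* Main.v *)
Require Import Defs.
From HB Require Import structures.
From mathcomp Require Import all_boot all_order all_algebra.
From mathcomp Require Import all_classical all_reals all_analysis.
From mathcomp Require Import ring lra.

Set Implicit Arguments.
Unset Strict Implicit.
Unset Printing Implicit Defensive.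

Import Order.TTheory GRing.Theory Num.Theory.
Import numFieldNormedType.Exports.

Local Open Scope classical_set_scope.
Local Open Scope ring_scope.

(** Each f_a is a shear along the line of a: it fixes the value s = Omega a z,
because Omega a a = 0, so its inverse is the shear with the opposite
coefficient. A direct computation ([pullback_shear]) gives the pullback of
the Liouville form theta by a shear z + c s^(m+1) a: it is theta minus
(c m / 2) s^(m+1) Omega(a, .). For c = -1/n and m = n the correction is exactly
d psi^a, so theta^a is the pullback of theta by the inverse of f_a
([theta_aE]). Pulling a form back by a diffeomorphism conjugates its
automorphism group ([Aut_pullback]), which reduces the theorem to
Aut(V, theta) = Sp(V, Omega) ([Aut_liouville]).

A linear symplectic map clearly preserves theta. Conversely, let g preserve
theta, that is, Omega(g z, Dg_z v) = Omega(z, v) for all z and v.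
- Differentiating this identity in the direction w, exchanging v and w and
  subtracting, the second derivatives of g cancel by their symmetry
  ([derive_comm]) and there remains Omega(Dg_z v, Dg_z w) = Omega(v, w); this is
  the invariance of d theta.
- Comparing with the identity itself, Omega(g z - Dg_z z, Dg_z v) = 0 for all v.
  As Dg_z is onto and Omega nonsingular, g z = Dg_z z: the map g commutes with
  the Euler field, the field dual to theta.
- A C^2 solution of g z = Dg_z z is linear ([homogeneous_diff_eq]).
All of this is done in the coordinates of a fixed basis, where smoothness is
the differentiability of all iterated directional derivatives
([liouville_preserving]).

Smoothness in this sense is stable under sums, products with scalar functions
and composition ([Ck_scale], [Ck_comp]), so the maps f_a and their conjugates of
linear maps are diffeomorphisms. *)

(** * Directional derivatives *)

Section DirectionalDerivatives.
Variable R : realType.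
Implicit Types U V W : normedModType R.

(** Turns a directional derivative into an ordinary one, so that the mean value
theorem applies along a line. *)
Lemma is_derive_line V W (f : V -> W) x v t :
  derivable f (x + t *: v) v ->
  is_derive t 1 (fun s => f (x + s *: v)) ('D_v f (x + t *: v)).
Proof.
have E : (fun h : R =>
      h^-1 *: (((fun s => f (x + s *: v)) \o shift t) (h *: 1) -
               f (x + t *: v))) =
    (fun h => h^-1 *: ((f \o shift (x + t *: v)) (h *: v) - f (x + t *: v))).
  apply/funext => h /=; congr (_ *: (f _ - _)).
  by rewrite [h%:A]mulr1 scalerDl addrCA.
by move=> df; apply: DeriveDef; rewrite /derivable /derive /= E.
Qed.

Lemma is_derive_scale V W (k : V -> R) (f : V -> W) x v dk df :
  is_derive x v k dk -> is_derive x v f df ->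
  is_derive x v (fun y => k y *: f y) (dk *: f x + k x *: df).
Proof.
move=> [kd <-] [fd <-].
suff H : (fun h => h^-1 *:
      (((fun y => k y *: f y) \o shift x) (h *: v) - k x *: f x)) @ 0^' -->
    'D_v k x *: f x + k x *: 'D_v f x.
  by apply: DeriveDef; [apply/cvg_ex; eexists; exact: H|exact: cvg_lim H].
have -> : (fun h => h^-1 *:
      (((fun y => k y *: f y) \o shift x) (h *: v) - k x *: f x)) =
    (fun h => (h^-1 *: (k (h *: v + x) - k x)) *: f x +
       k (h *: v + x) *: (h^-1 *: (f (h *: v + x) - f x))).
  apply/funext => h /=.
  rewrite scalerA [k (h *: v + x) * _]mulrC -!scalerA -scalerDr; congr (_ *: _).
  by rewrite scalerBl scalerBr [RHS]addrC subrKA.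
apply: cvgD; first by apply: cvgZr_tmp; exact: kd.
apply: cvgZ; last exact: fd.
suff : {for 0, continuous (fun h : R => k (h *: v + x))}.
  by move=> /continuous_withinNx; rewrite scale0r add0r.
exact/differentiable_continuous/derivable1_diffP/(derivable1P _ _ _).1.
Qed.

Lemma derive_comp U V W (f : U -> V) (g : V -> W) x v :
  differentiable f x -> differentiable g (f x) ->
  'D_v (g \o f) x = 'D_('D_v f x) g (f x).
Proof.
move=> df dg; rewrite !deriveE//; last exact: differentiable_comp.
by rewrite diff_comp.
Qed.

Lemma derive_linear_dir V W (f : V -> W) x :
  differentiable f x -> linear (fun v => 'D_v f x).
Proof. by move=> df a u v; rewrite !deriveE// linearP. Qed.

Lemma is_derive_coord V m n (M : V -> 'M[R]_(m, n)) x v dM i j :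
  is_derive x v M dM -> is_derive x v (fun y => M y i j) (dM i j).
Proof.
move=> [Md <-]; apply: DeriveDef; first exact: (derivable_mxP _ _ _).1.
by rewrite derive_mx// mxE.
Qed.

Lemma differentiable_rowP V q (f : V -> 'rV[R]_q) x :
  differentiable f x <-> forall j, differentiable (fun y => f y 0 j) x.
Proof.
split=> [df j|df].
  apply: (@differentiable_comp _ _ _ _ f (fun M : 'rV[R]_q => M 0 j)) => //.
  exact: differentiable_coord.
have -> : f = \sum_j (fun y => f y 0 j *: delta_mx 0 j).
  by apply/funext => y; rewrite fct_sumE [LHS]row_sum_delta.
apply: differentiable_sum => j; exact: differentiableZl.
Qed.

(** The mean value theorem, applied first in the direction v to the difference
of f between two parallel segments and then in the direction w. The left-hand
side is symmetric in v and w; this is what makes mixed derivatives commute. *)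
Lemma second_difference V (f : V -> R) x v w (h : R) : 0 < h ->
  (forall y, derivable f y v) -> (forall y, derivable ('D_v f) y w) ->
  exists s t, [/\ s \in `]0, h[, t \in `]0, h[ &
   f (x + h *: v + h *: w) + f x - (f (x + h *: v) + f (x + h *: w)) =
   'D_w ('D_v f) (x + s *: v + t *: w) * h * h].
Proof.
move=> h0 dv dwv.
pose phi (s : R) := f (x + h *: w + s *: v) - f (x + s *: v).
pose dphi (s : R) : R := 'D_v f (x + h *: w + s *: v) - 'D_v f (x + s *: v).
have dphiE (s : R) : is_derive s 1 phi (dphi s).
  by apply: is_deriveB; exact: is_derive_line.
have cphi : {within `[0, h], continuous phi}.
  apply: derivable_within_continuous => s _.
  by have [] := dphiE s.
have [s sI phiE] := MVT h0 (fun s _ => dphiE s) cphi.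
pose chi (t : R) : R := 'D_v f (x + s *: v + t *: w).
have dchi (t : R) : is_derive t 1 chi ('D_w ('D_v f) (x + s *: v + t *: w)).
  exact: is_derive_line.
have cchi : {within `[0, h], continuous chi}.
  apply: derivable_within_continuous => t _.
  by have [] := dchi t.
have [t tI chiE] := MVT h0 (fun t _ => dchi t) cchi.
exists s, t; split => //; rewrite opprD addrACA -[f x - _]opprB.
move: chiE phiE; rewrite !subr0 => <-.
rewrite /phi /dphi /chi !scale0r !addr0 [x + h *: v + h *: w]addrAC.
by rewrite [x + h *: w + s *: v]addrAC => <-.
Qed.

(** Both mixed derivatives take a common value, the second difference divided by
the square of the step, at points as close to x as desired; by continuity they
agree at x. *)
Lemma derive_comm_scalar V (f : V -> R) x v w :
  (forall y, derivable f y v) -> (forall y, derivable f y w) ->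
  (forall y, derivable ('D_v f) y w) -> (forall y, derivable ('D_w f) y v) ->
  {for x, continuous ('D_w ('D_v f))} -> {for x, continuous ('D_v ('D_w f))} ->
  'D_w ('D_v f) x = 'D_v ('D_w f) x.
Proof.
move=> dv dw dwv dvw cwv cvw.
apply/eqP; rewrite -subr_eq0 -normr_le0.
apply/ler_addgt0Pr => e e0; rewrite add0r.
have e2 : 0 < e / 2 by rewrite divr_gt0.
have /nbhs_ballP[d /= d0 dP] : \forall y \near x,
    `|'D_w ('D_v f) x - 'D_w ('D_v f) y| < e / 2 /\
    `|'D_v ('D_w f) x - 'D_v ('D_w f) y| < e / 2.
  apply: filterI; first by have /cvgrPdist_lt := cwv; exact.
  by have /cvgrPdist_lt := cvw; exact.
(* The 1 keeps the step h positive when v = w = 0. *)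
pose N := `|v| + `|w| + 1.
have N0 : 0 < N by rewrite ltr_wpDl// addr_ge0.
pose h := d / N.
have h0 : 0 < h by rewrite divr_gt0.
have inball s t v' w' : s \in `]0, h[ -> t \in `]0, h[ ->
    `|v'| + `|w'| + 1 = N -> ball x d (x + s *: v' + t *: w').
  rewrite !in_itv/= => /andP[s0 sh] /andP[t0 th] NE.
  rewrite -ball_normE /ball_/=.
  rewrite opprD opprD addrA addrA subrr add0r -opprD normrN.
  rewrite (le_lt_trans (ler_normD _ _))// !normrZ !gtr0_norm//.
  have -> : d = h * `|v'| + h * `|w'| + h.
    by rewrite -[X in _ + X]mulr1 -!mulrDr NE divfK// gt_eqF.
  rewrite (@le_lt_trans _ _ (h * `|v'| + h * `|w'|)) ?ltrDl//.
  by rewrite lerD// ler_wpM2r// ltW.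
have [s [t [sI tI E1]]] := second_difference x h0 dv dwv.
have [s' [t' [sI' tI' E2]]] := second_difference x h0 dw dvw.
have [H1 _] := dP _ (inball s t v w sI tI erefl).
have NC : `|w| + `|v| + 1 = N by rewrite [`|w| + _]addrC.
have [_ H2] := dP _ (inball s' t' w v sI' tI' NC).
have E : 'D_w ('D_v f) (x + s *: v + t *: w) =
    'D_v ('D_w f) (x + s' *: w + t' *: v).
  apply: (mulIf (lt0r_neq0 h0)); apply: (mulIf (lt0r_neq0 h0)).
  by rewrite -[LHS]E1 -[RHS]E2 [x + h *: w + _]addrAC [X in _ - X]addrC.
move: E H1 H2; move: ('D_w _ (_ + _)) ('D_v _ (_ + _)) => _ z ->.
move: ('D_w _ x) ('D_v _ x) => p q H1 H2.
rewrite -(subrKA z) (splitr e) (le_trans (ler_normD _ _))// lerD// ltW//.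
by rewrite distrC.
Qed.

End DirectionalDerivatives.

(** * Maps of class C^k between coordinate spaces *)

Section CkMaps.
Variable R : realType.

(** Symmetry of second derivatives, coordinate by coordinate. *)
Lemma derive_comm p q (f : 'rV[R]_p -> 'rV[R]_q) x v w :
  Ck 2 f -> 'D_w (fun y => 'D_v f y) x = 'D_v (fun y => 'D_w f y) x.
Proof.
move=> [df Cf]; apply/rowP => j.
pose fj y := f y 0 j.
have d1 u y : is_derive y u fj ('D_u f y 0 j).
  exact/is_derive_coord/derivableP/diff_derivable.
have E1 u : 'D_u fj = fun y => 'D_u f y 0 j.
  by apply/funext => y; have [_] := d1 u y.
have d2 u u' y : is_derive y u' ('D_u fj) ('D_u' (fun y => 'D_u f y) y 0 j).
  rewrite E1; apply/is_derive_coord/derivableP/diff_derivable.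
  by have [] := Cf u.
have E2 u u' : 'D_u' ('D_u fj) = fun y => 'D_u' (fun y => 'D_u f y) y 0 j.
  by apply/funext => y; have [_] := d2 u u' y.
have c2 u u' : {for x, continuous ('D_u' ('D_u fj))}.
  rewrite E2; apply: (@continuous_comp _ _ _
    (fun y => 'D_u' (fun y => 'D_u f y) y) (fun M : 'rV[R]_q => M 0 j));
    last exact: coord_continuous.
  by have [_ C1] := Cf u; exact: (C1 u' x).
have [_ e1] := d2 v w x; have [_ e2] := d2 w v x.
apply: etrans (esym e1) (etrans _ e2).
apply: derive_comm_scalar (c2 v w) (c2 w v) => y.
- by have [] := d1 v y.
- by have [] := d1 w y.
- by have [] := d2 v w y.
- by have [] := d2 w v y.
Qed.

Lemma Ck_continuous p q k (f : 'rV[R]_p -> 'rV[R]_q) : Ck k f -> continuous f.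
Proof. by case: k => [//|k [df _] x]; exact: differentiable_continuous. Qed.

Lemma CkW p q k (f : 'rV[R]_p -> 'rV[R]_q) : Ck k.+1 f -> Ck k f.
Proof.
elim: k f => [|k IH] f Cf; first exact: (Ck_continuous Cf).
by case: Cf => df Cf; split => // v; exact: IH.
Qed.

Lemma Ck_cst p q k (c : 'rV[R]_q) : Ck k (fun _ : 'rV[R]_p => c).
Proof.
elim: k c => [|k IH] c /=; first exact: cst_continuous.
split=> [x|v]; first exact: differentiable_cst.
have -> : (fun x => 'D_v (fun=> c) x) = fun=> 0.
  by apply/funext => x; exact: derive_cst.
exact: IH.
Qed.

Lemma Ck_id p k : Ck k (@id 'rV[R]_p).
Proof.
case: k => [|k] /=; first by move=> x; exact: cvg_id.
split=> [x|v]; first exact: ex_diff.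
have -> : (fun x => 'D_v id x) = fun=> v.
  by apply/funext => x; exact: derive_id.
exact: Ck_cst.
Qed.

Lemma CkD p q k (f g : 'rV[R]_p -> 'rV[R]_q) :
  Ck k f -> Ck k g -> Ck k (fun x => f x + g x).
Proof.
elim: k f g => [|k IH] f g /= Cf Cg;
  first by move=> x; exact: (cvgD (Cf x) (Cg x)).
have [df Df] := Cf; have [dg Dg] := Cg.
split=> [x|v]; first exact: (differentiableD (df x) (dg x)).
have -> : (fun x => 'D_v (fun x => f x + g x) x) = fun x => 'D_v f x + 'D_v g x.
  by apply/funext => x; apply: deriveD; exact: diff_derivable.
exact: IH.
Qed.

Lemma Ck_sum p q k n (f : 'I_n -> 'rV[R]_p -> 'rV[R]_q) :
  (forall i, Ck k (f i)) -> Ck k (fun x => \sum_i f i x).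
Proof.
move=> Cf; elim: (index_enum _) => [|i s IH].
  by under eq_fun do rewrite big_nil; exact: Ck_cst.
by under eq_fun do rewrite big_cons; exact: CkD.
Qed.

Lemma Ck_scale p q r k (f : 'rV[R]_p -> 'rV[R]_q) (u : 'rV[R]_p -> 'rV[R]_r) i :
  Ck k f -> Ck k u -> Ck k (fun x => f x 0 i *: u x).
Proof.
elim: k f u => [|k IH] f u /=.
  move=> Cf Cu x.
  have cfi : {for x, continuous (fun y => f y 0 i)}.
    apply: (@continuous_comp _ _ _ f (fun M : 'rV[R]_q => M 0 i)).
      exact: (Cf x).
    exact: coord_continuous.
  exact: (cvgZ cfi (Cu x)).
move=> [df Df] [du Du].
split=> [x|v].
  apply/differentiable_rowP => j.
  rewrite (_ : (fun y => _) = (fun y => f y 0 i) * (fun y => u y 0 j)).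
    by apply: differentiableM; exact: (differentiable_rowP _ _).1.
  by apply/funext => y; rewrite mxE.
have -> : (fun x => 'D_v (fun x => f x 0 i *: u x) x) =
    fun x => 'D_v f x 0 i *: u x + f x 0 i *: 'D_v u x.
  apply/funext => x; apply: derive_val.
  by apply: is_derive_scale; [apply/is_derive_coord|];
    exact/derivableP/diff_derivable.
by apply: CkD; apply: IH; solve [exact: Df|exact: Du|exact: CkW].
Qed.

Lemma Ck_linear p q k (L : {linear 'rV[R]_p -> 'rV[R]_q}) : Ck k L.
Proof.
have -> : (L : _ -> _) = fun x => \sum_i x 0 i *: L (delta_mx 0 i).
  apply/funext => x; rewrite {1}[x]row_sum_delta linear_sum.
  by apply: eq_bigr => i _; rewrite linearZ.
apply: Ck_sum => i; apply: (@Ck_scale _ _ _ k id); [exact: Ck_id|exact: Ck_cst].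
Qed.

(** The chain rule writes the derivative of the composite as a sum, over the
basis vectors e_i, of the i-th coordinate of the derivative of f times the
composite of f with the derivative of g along e_i; the induction hypothesis
applies to each of these composites. *)
Lemma Ck_comp p q r k (f : 'rV[R]_p -> 'rV[R]_q) (g : 'rV[R]_q -> 'rV[R]_r) :
  Ck k f -> Ck k g -> Ck k (g \o f).
Proof.
elim: k f g => [|k IH] f g.
  by move=> Cf Cg x; apply: continuous_comp; [exact: (Cf x)|exact: (Cg (f x))].
move=> Cf Cg; have [df Df] := Cf; have [dg Dg] := Cg.
split=> [x|v]; first exact: differentiable_comp.
have -> : (fun x => 'D_v (g \o f) x) =
    fun x => \sum_i 'D_v f x 0 i *: ((fun y => 'D_(delta_mx 0 i) g y) \o f) x.
  apply/funext => x; rewrite derive_comp// deriveE// {1}['D_v f x]row_sum_delta.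
  rewrite linear_sum; apply: eq_bigr => i _; rewrite linearZ/=.
  by rewrite [in RHS](deriveE _ (dg _)).
apply: Ck_sum => i; apply: Ck_scale; first exact: Df.
by apply: IH; [exact: CkW|exact: Dg].
Qed.

End CkMaps.

(** * Maps preserving a Liouville form in coordinates *)

Lemma alternating_antisymmetric (R : nzRingType) (U : lmodType R)
    (s s' : R -> R -> R) (B : {bilinear U -> U -> R | s & s'}) :
  (forall x, B x x = 0) -> forall u w, B u w = - B w u.
Proof.
move=> alt u w; apply/eqP; rewrite -subr_eq0 opprK; apply/eqP.
by have := alt (u + w); rewrite linearDl !linearDr !alt add0r addr0.
Qed.

Section LiouvillePreserving.
Variable R : realType.

(** Expanding B on the standard basis reduces this Leibniz rule to the one for
products of coordinates, with no separate proof that B is continuous. *)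
Lemma is_derive_bilinear (U : normedModType R) p q
    (B : {bilinear 'rV[R]_p -> 'rV[R]_q -> R | *%R & *%R})
    (f : U -> 'rV[R]_p) (g : U -> 'rV[R]_q) x v df dg :
  is_derive x v f df -> is_derive x v g dg ->
  is_derive x v (fun y => B (f y) (g y)) (B df (g x) + B (f x) dg).
Proof.
move=> Df Dg.
have BE u w : B u w =
    \sum_i \sum_j (u 0 i * w 0 j) * B (delta_mx 0 i) (delta_mx 0 j).
  rewrite {1}[u]row_sum_delta linear_sumlz; apply: eq_bigr => i _.
  rewrite linearZl_LR {1}[w]row_sum_delta linear_sumr /= mulr_sumr.
  by apply: eq_bigr => j _; rewrite linearZr_LR /= mulrA.
have -> : (fun y => B (f y) (g y)) = \sum_i \sum_j
    (fun y => (f y 0 i * g y 0 j) *: B (delta_mx 0 i) (delta_mx 0 j)).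
  apply/funext => y; rewrite BE fct_sumE; apply: eq_bigr => i _.
  by rewrite fct_sumE.
apply: is_derive_eq.
  apply: is_derive_sum => i; apply: is_derive_sum => j.
  apply: is_derive_scale.
  apply: (is_deriveM (is_derive_coord 0 i Df) (is_derive_coord 0 j Dg)).
rewrite !BE -big_split; apply: eq_bigr => i _.
rewrite -big_split; apply: eq_bigr => j _ /=.
by rewrite scaler0 addr0 -mulrDl addrC [g x 0 j *: _]mulrC.
Qed.

(** Euler's relation makes G homogeneous of degree 1, and such a map is linear
as soon as it is differentiable at 0. With one more derivative the proof avoids
any limit: m(t), the derivative of G in the direction x at t x, satisfies both
G(t x) = t m(t) and d/dt G(t x) = m(t), hence t m'(t) = 0, so that m is constant
on the unit interval and G x = m(1) = m(0). *)
Lemma homogeneous_diff_eq p q (G : 'rV[R]_p -> 'rV[R]_q) :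
  Ck 2 G -> (forall x, G x = 'D_x G x) -> forall x, G x = 'D_x G 0.
Proof.
move=> [dG CG] euler x.
pose m (t : R) := 'D_x G (0 + t *: x).
pose m' (t : R) := 'D_x (fun y => 'D_x G y) (0 + t *: x).
have mE (t : R) : is_derive t 1 m (m' t).
  by apply: is_derive_line; apply: diff_derivable; have [] := CG x.
have GE : (fun t : R => G (0 + t *: x)) = fun t => t *: m t.
  apply/funext => t; rewrite euler /m add0r.
  have := derive_linear_dir (dG (t *: x)) t x 0.
  by rewrite derive0 !addr0.
have m'0 (t : R) : t *: m' t = 0.
  have [_ h1] : is_derive t 1 (fun s : R => G (0 + s *: x)) (m t).
    exact/is_derive_line/diff_derivable.
  have [_ h2] := is_derive_scale (is_derive_id t (1 : R)) (mE t).
  move: h1; rewrite GE h2 scale1r => /eqP.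
  by rewrite -subr_eq0 addrC addKr => /eqP.
have -> : G x = m 1 by rewrite /m add0r scale1r.
have -> : 'D_x G 0 = m 0 by rewrite /m scale0r addr0.
apply/rowP => j; apply/eqP; rewrite -subr_eq0; apply/eqP.
have mjE (t : R) : is_derive t 1 (fun s => m s 0 j) (m' t 0 j).
  exact: is_derive_coord.
have cm : {within `[0, 1], continuous (fun s => m s 0 j)}.
  by apply: derivable_within_continuous => t _; have [] := mjE t.
have [c + ->] := MVT ltr01 (fun t _ => mjE t) cm.
rewrite in_itv /= => /andP[c0 _].
have /eqP := m'0 c; rewrite scaler_eq0 gt_eqF //= => /eqP ->.
by rewrite mxE mul0r.
Qed.

(** The last hypothesis holds when B is nonsingular and the derivative of G is
onto: it is what the proof that G x = 'D_x G x takes from these two facts. *)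
Lemma liouville_preserving p (B : {biscalar 'rV[R]_p})
    (G : 'rV[R]_p -> 'rV[R]_p) :
  (forall x, B x x = 0) -> Ck 2 G ->
  (forall x v, B (G x) ('D_v G x) = B x v) ->
  (forall x u, (forall v, B u ('D_v G x) = 0) -> u = 0) ->
  (forall x, G x = 'D_x G 0) /\
  (forall v w, B ('D_v G 0) ('D_w G 0) = B v w).
Proof.
move=> alt CG pres nondeg; have [dG DG] := CG.
have anti := alternating_antisymmetric alt.
have d1 x v w :
    B ('D_w G x) ('D_v G x) + B (G x) ('D_w (fun y => 'D_v G y) x) = B w v.
  have Dw : is_derive x w G ('D_w G x) by exact/derivableP/diff_derivable.
  have Dvw : is_derive x w (fun y => 'D_v G y) ('D_w (fun y => 'D_v G y) x).
    by apply/derivableP/diff_derivable; have [] := DG v.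
  have [_ <-] := is_derive_bilinear B Dw Dvw.
  rewrite (_ : (fun y => B (G y) ('D_v G y)) = fun y => B y v); last first.
    by apply/funext => y; exact: pres.
  have [_ ->] := is_derive_bilinear B (is_derive_id x w) (is_derive_cst v x w).
  by rewrite linear0r addr0.
have isom x v w : B ('D_v G x) ('D_w G x) = B v w.
  have e1 := d1 x w v; have e2 := d1 x v w.
  have e3 := derive_comm x v w CG.
  move: e1 e2; rewrite -e3 [B ('D_w G x) _]anti [B w v]anti.
  by move: (B _ _) (B _ _) (B v w) => b c d; lra.
split; last by move=> v w; exact: isom.
apply: homogeneous_diff_eq => // x.
apply/eqP; rewrite -subr_eq0; apply/eqP; apply: (nondeg x) => v.
by rewrite linearBl pres isom subrr.
Qed.

End LiouvillePreserving.

(** * Smooth maps and one-forms on a vector space *)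

Section VectorSpaces.
Variable R : realType.
Implicit Types U V W : vectType R.

HB.instance Definition _ V := GRing.isLinear.Build R V _ _ (@chart R V)
  (passmx.rVof_linear (vbasis {:V})).
HB.instance Definition _ V := GRing.isLinear.Build R _ V _ (@unchart R V)
  (@passmx.vecof_linear _ _ (vbasis {:V})).

Lemma chartK V : cancel (@chart R V) (@unchart R V).
Proof. exact/passmx.rVofK/vbasisP. Qed.

Lemma unchartK V : cancel (@unchart R V) (@chart R V).
Proof. exact/passmx.vecofK/vbasisP. Qed.

Definition in_chart V W (g : V -> W) := @chart R W \o g \o @unchart R V.

Lemma in_chart_comp U V W (f : U -> V) (g : V -> W) :
  in_chart (g \o f) = in_chart g \o in_chart f.
Proof. by apply/funext => x; rewrite /in_chart /= chartK. Qed.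

Lemma smooth_comp U V W (f : U -> V) (g : V -> W) :
  smooth f -> smooth g -> smooth (g \o f).
Proof.
move=> sf sg k; rewrite -/(in_chart _) in_chart_comp.
exact: Ck_comp (sf k) (sg k).
Qed.

Lemma smooth_linear V W (L : V -> W) : linear L -> smooth L.
Proof.
move=> linL k.
have linG : linear (in_chart L).
  by move=> c x y; rewrite /in_chart /= linearP linL linearP.
pose G : {linear _ -> _} :=
  HB.pack (in_chart L) (GRing.isLinear.Build _ _ _ _ _ linG).
exact: (@Ck_linear _ _ _ k G).
Qed.

Lemma smooth_id V : smooth (@id V).
Proof. exact: smooth_linear. Qed.

Lemma smoothD V W (f g : V -> W) :
  smooth f -> smooth g -> smooth (fun z => f z + g z).
Proof.
move=> sf sg k; have := CkD (sf k) (sg k); congr (Ck k _).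
by apply/funext => x; rewrite /= linearD.
Qed.

(** Iterating this with l = Omega a shows that monomials in Omega a z are
smooth, without a notion of smooth scalar function. *)
Lemma smooth_scale V W (l : {scalar V}) (f : V -> W) :
  smooth f -> smooth (fun z => l z *: f z).
Proof.
move=> sf k.
have : Ck k (fun x => \sum_i
    x 0 i *: (l (unchart (delta_mx 0 i)) *: (chart (f (unchart x))))).
  apply: Ck_sum => i; apply: (Ck_scale i (@Ck_id _ _ k)).
  have -> : (fun x => l (unchart (delta_mx 0 i)) *: chart (f (unchart x))) =
      *:%R (l (unchart (delta_mx 0 i))) \o in_chart f by [].
  apply: (Ck_comp (sf k)).
  exact: (@Ck_linear _ _ _ k ( *:%R (l (unchart (delta_mx 0 i))))).
congr (Ck k _); apply/funext => x.
have lE : (l \o @unchart R V) x =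
    \sum_i x 0 i * (l \o @unchart R V) (delta_mx 0 i).
  rewrite {1}[x]row_sum_delta linear_sum.
  by apply: eq_bigr => i _; rewrite linearZ.
rewrite /= linearZ /= -/((l \o @unchart R V) x) lE scaler_suml.
by apply: eq_bigr => i _; rewrite scalerA.
Qed.

Lemma tangent_mapE V (g : V -> V) z v :
  tangent_map g z v = unchart ('D_(chart v) (in_chart g) (chart z)).
Proof.
rewrite /tangent_map /derive1 /derive; congr (unchart (lim (_ @ 0^'))).
apply/funext => h.
rewrite /in_chart /= scale0r !addr0 [z + _]addrC chartK.
have -> : h *: chart v + chart z = chart (h *: v + z) by rewrite linearP.
by rewrite chartK.
Qed.

Lemma tangent_map_derive V (g : V -> V) z v w :
  is_derive (0 : R) 1 (fun t => chart (g (z + t *: v))) (chart w) ->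
  tangent_map g z v = w.
Proof. by case=> _ E; rewrite /tangent_map derive1E E chartK. Qed.

Lemma smooth_differentiable V W (g : V -> W) x :
  smooth g -> differentiable (in_chart g) x.
Proof. by move=> /(_ 1%N)[]. Qed.

Lemma tangent_map_comp V (f g : V -> V) z v : smooth f -> smooth g ->
  tangent_map (g \o f) z v = tangent_map g (f z) (tangent_map f z v).
Proof.
move=> sf sg; rewrite !tangent_mapE in_chart_comp derive_comp; first last.
- exact: smooth_differentiable.
- exact: smooth_differentiable.
by rewrite unchartK /in_chart /= chartK.
Qed.

Lemma tangent_map_linear V (L : V -> V) z v :
  linear L -> tangent_map L z v = L v.
Proof.
move=> linL; apply: tangent_map_derive.
have -> : (fun t : R => chart (L (z + t *: v))) =
    (fun t => chart (L z) + t *: chart (L v)).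
  by apply/funext => t; rewrite addrC linL addrC linearD linearZ.
apply: is_derive_eq.
  by apply: is_deriveD; apply: is_derive_scale.
by rewrite scaler0 scale1r addr0 add0r.
Qed.

Lemma pullback_comp V (f g : V -> V) (alpha : one_form V) :
  smooth f -> smooth g ->
  pullback (g \o f) alpha = pullback f (pullback g alpha).
Proof.
move=> sf sg; apply/funext => z; apply/funext => v.
by rewrite /pullback /= tangent_map_comp.
Qed.

Lemma pullback_id V (alpha : one_form V) : pullback id alpha = alpha.
Proof.
apply/funext => z; apply/funext => v.
by rewrite /pullback tangent_map_linear.
Qed.

Lemma diffeomorphism_comp V (f g : V -> V) :
  diffeomorphism f -> diffeomorphism g -> diffeomorphism (g \o f).
Proof.
move=> [sf [f' [fK f'K sf']]] [sg [g' [gK g'K sg']]].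
split; first exact: smooth_comp.
exists (f' \o g'); split; [exact: can_comp|exact: can_comp|exact: smooth_comp].
Qed.

(** Functoriality of the pullback: g preserves h^* alpha if and only if h g f
preserves alpha. *)
Lemma Aut_pullback V (f h : V -> V) (alpha : one_form V) :
  smooth f -> smooth h -> cancel f h -> cancel h f ->
  Aut (pullback h alpha) = [set f \o gamma \o h | gamma in Aut alpha].
Proof.
move=> sf sh fK hK.
have Df : diffeomorphism f by split => //; exists h.
have Dh : diffeomorphism h by split => //; exists f.
have fhE : f \o h = id by apply/funext => z; exact: hK.
have hfE : h \o f = id by apply/funext => z; exact: fK.
apply/seteqP; split => [g [Dg gP]|_ [gamma [Dgamma gammaP] <-]].
  exists (h \o g \o f).
    split; first by do 2![apply: diffeomorphism_comp => //].
    have sg := Dg.1.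
    rewrite pullback_comp//; last exact: smooth_comp.
    by rewrite pullback_comp// gP -pullback_comp// hfE pullback_id.
  by apply/funext => z; rewrite /= !hK.
have sgamma := Dgamma.1.
split; first by do 2![apply: diffeomorphism_comp => //].
rewrite -pullback_comp//; last by do 2![apply: smooth_comp => //].
have -> : h \o (f \o gamma \o h) = gamma \o h.
  by apply/funext => z; rewrite /= fK.
by rewrite pullback_comp// gammaP.
Qed.

End VectorSpaces.

(** * Automorphisms of the Liouville form *)

Section LiouvilleForms.
Variables (R : realType) (V : vectType R) (Omega : {biscalar V}).

Definition chart_form (x y : 'rV[R]_(\dim {:V})) : R :=
  Omega (unchart x) (unchart y).

Lemma chart_form_bilinear : bilinear_for *%R *%R chart_form.
Proof.
split=> u c x y; rewrite /chart_form linearP.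
  by rewrite linearPl.
by rewrite linearPr.
Qed.

HB.instance Definition _ :=
  bilinear_isBilinear.Build R _ _ R *%R *%R chart_form chart_form_bilinear.

Lemma linear_inverse (g h : V -> V) :
  linear g -> cancel g h -> cancel h g -> linear h.
Proof.
move=> ling gK hK c x y; apply: (can_inj gK).
by rewrite hK ling !hK.
Qed.

(** The derivative of a diffeomorphism is onto because the derivative of the
inverse map provides preimages; this and the nonsingularity of Omega are what
[liouville_preserving] needs in coordinates. *)
Lemma Aut_liouville : symplectic Omega -> Aut (liouville Omega) = Sp Omega.
Proof.
move=> [alt nondeg]; apply/seteqP; split => g.
  move=> [[sg [h [gK hK sh]]] gP].
  have presE z v : Omega (g z) (tangent_map g z v) = Omega z v.
    have := congr1 (fun al : one_form V => al z v) gP.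
    by apply: mulfI; rewrite invr_eq0.
  have surj z w : exists v, tangent_map g z v = w.
    exists (tangent_map h (g z) w).
    have hgK : g \o h = id by apply/funext => y; exact: hK.
    by rewrite -{1}[z]gK -tangent_map_comp// hgK tangent_map_linear.
  pose G := in_chart g.
  have presG x v : chart_form (G x) ('D_v G x) = chart_form x v.
    have := presE (unchart x) (unchart v).
    by rewrite tangent_mapE !unchartK /chart_form /G /in_chart /= chartK.
  have nondegG x u : (forall v, chart_form u ('D_v G x) = 0) -> u = 0.
    move=> u0; apply: (can_inj (@unchartK R V)); rewrite linear0.
    apply: nondeg => y.
    have [w <-] := surj (unchart x) y.
    by rewrite tangent_mapE unchartK; exact: u0.
  have altB x : chart_form x x = 0 by exact: alt.
  have [GE isoG] := liouville_preserving altB (sg 2%N) presG nondegG.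
  have gE z : g z = unchart ('D_(chart z) G 0).
    by rewrite -GE /G /in_chart /= !chartK.
  split; [|by exists h|].
    move=> c x y; rewrite !gE linearP.
    by rewrite derive_linear_dir ?linearP//; exact: smooth_differentiable.
  move=> x y; rewrite !gE -[in RHS](chartK x) -[in RHS](chartK y); exact: isoG.
move=> [ling [h gK hK] presg].
split; first split; first exact: smooth_linear.
  by exists h; split => //; apply: smooth_linear; exact: linear_inverse gK hK.
apply/funext => z; apply/funext => v.
by rewrite /pullback /liouville tangent_map_linear// presg.
Qed.

End LiouvilleForms.

(** * Shears *)

Section Shears.
Variables (R : realType) (V : vectType R) (Omega : {biscalar V}) (a : V).
Hypothesis alt : forall x, Omega x x = 0.

(** The maps f_a and f_a^-1 are the cases m = n + 1 and c = 1/n, -1/n. *)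
Definition shear (m : nat) (c : R) (z : V) : V :=
  z + (c * Omega a z ^+ m) *: a.

Lemma form_shear m c z : Omega a (shear m c z) = Omega a z.
Proof. by rewrite /shear linearDr linearZr_LR /= alt mulr0 addr0. Qed.

Lemma shearK m c : cancel (shear m c) (shear m (- c)).
Proof.
move=> z; rewrite {1}/shear form_shear /shear mulNr scaleNr.
by rewrite addrK.
Qed.

Lemma smooth_shear m c : smooth (shear m c).
Proof.
apply: smoothD; first exact: smooth_id.
have : smooth (fun _ : V => c *: a).
  by move=> k; exact: Ck_cst.
elim: m => [|m IH] sc.
  by under eq_fun do rewrite mulr1.
have := smooth_scale (Omega a) (IH sc).
by under eq_fun do rewrite scalerA mulrCA -exprS.
Qed.

Lemma is_derive_form_line z v (t : R) :
  is_derive t 1 (fun s : R => Omega a (z + s *: v)) (Omega a v).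
Proof.
have -> : (fun s : R => Omega a (z + s *: v)) =
    (fun s => Omega a z + s *: Omega a v).
  by apply/funext => s; rewrite linearDr linearZr_LR.
have := is_deriveD (is_derive_cst (Omega a z) t 1)
  (is_derive_scale (is_derive_id t (1 : R)) (is_derive_cst (Omega a v) t 1)).
by rewrite scaler0 scale1r addr0 add0r.
Qed.

Lemma is_derive_form_lineX z v m :
  is_derive (0 : R) 1 (fun s : R => Omega a (z + s *: v) ^+ m.+1)
    (m.+1%:R * Omega a z ^+ m * Omega a v).
Proof.
have := is_deriveX m.+1 (is_derive_form_line z v 0).
rewrite scale0r addr0 exprfctE; exact.
Qed.

Lemma tangent_map_shear m c z v :
  tangent_map (shear m.+1 c) z v =
  v + (c * (m.+1%:R * Omega a z ^+ m * Omega a v)) *: a.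
Proof.
apply: tangent_map_derive.
have -> : (fun t : R => chart (shear m.+1 c (z + t *: v))) =
    (fun t => (chart z + t *: chart v) +
              (c *: Omega a (z + t *: v) ^+ m.+1) *: chart a).
  by apply/funext => t; rewrite /shear !linearD !linearZ.
rewrite linearD linearZ.
apply: is_derive_eq.
  apply: is_deriveD; first by apply: is_deriveD; apply: is_derive_scale.
  apply: is_derive_scale; apply: is_deriveZ; exact: is_derive_form_lineX.
by rewrite !scaler0 !addr0 add0r scale1r.
Qed.

Lemma extd_psi_a n z v :
  extd (psi_a Omega n a) z v = 2^-1 * (Omega a z ^+ n.+1 * Omega a v).
Proof.
rewrite /extd /tangent derive1E /psi_a.
have [_ ->] := is_deriveZ (2 * n.+2%:R)^-1 (is_derive_form_lineX z v n.+1).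
rewrite invfM -scalerA; congr (_ * _).
by rewrite -[_ *: _]/(_ * _) !mulrA mulVf ?mul1r// pnatr_eq0.
Qed.

(** The two corrections to theta, from the derivative of the shear and from its
value, are proportional, with factors -(m + 1) and 1; they add up to -m. *)
Lemma pullback_shear m c :
  pullback (shear m.+1 c) (liouville Omega) =
  fun z v => 2^-1 * (Omega z v - c * m%:R * (Omega a z ^+ m.+1 * Omega a v)).
Proof.
apply/funext => z; apply/funext => v.
rewrite /pullback /liouville tangent_map_shear; congr (_ * _).
have Zl k u w : Omega (k *: u) w = k * Omega u w by rewrite linearZl_LR.
have Zr k u w : Omega u (k *: w) = k * Omega u w by rewrite linearZr_LR.
rewrite linearDr !linearDl !Zl !Zr alt (alternating_antisymmetric alt z a).
rewrite exprS -addn1 natrD.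
by ring.
Qed.

End Shears.

Lemma f_a_invE (R : realType) (V : vectType R) (Omega : {biscalar V}) n a :
  f_a_inv Omega n a = shear Omega a n.+1 (- n%:R^-1).
Proof. by apply/funext => z; rewrite /f_a_inv /shear mulNr scaleNr. Qed.

(** The coefficient c = -1/n is the one for which the correction of
[pullback_shear] is d psi^a. *)
Lemma theta_aE (R : realType) (V : vectType R) (Omega : {biscalar V}) n a :
  (forall x, Omega x x = 0) -> (0 < n)%N ->
  theta_a Omega n a = pullback (f_a_inv Omega n a) (liouville Omega).
Proof.
move=> alt n0; rewrite f_a_invE pullback_shear//.
apply/funext => z; apply/funext => v.
rewrite /theta_a /liouville extd_psi_a// -mulrDr.
by rewrite mulNr mulVf ?pnatr_eq0 -?lt0n// mulN1r opprK.
Qed.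

Theorem theorem3p1 (R : realType) (V : vectType R) (Omega : {biscalar V})
    (sympl : symplectic Omega) (n : nat) (n_gt0 : (0 < n)%N) (a : V) :
  [/\ diffeomorphism (f_a Omega n a),
      cancel (f_a Omega n a) (f_a_inv Omega n a),
      cancel (f_a_inv Omega n a) (f_a Omega n a) &
      Aut (theta_a Omega n a) =
        [set f_a Omega n a \o gamma \o f_a_inv Omega n a
          | gamma in Sp Omega]].
Proof.
have alt := sympl.1.
have fE : f_a Omega n a = shear Omega a n.+1 n%:R^-1 by [].
have hE := f_a_invE Omega n a.
have fK : cancel (f_a Omega n a) (f_a_inv Omega n a).
  by rewrite fE hE; exact: shearK.
have hK : cancel (f_a_inv Omega n a) (f_a Omega n a).
  by rewrite fE hE -{2}[n%:R^-1]opprK; exact: shearK.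
have sf : smooth (f_a Omega n a) by rewrite fE; exact: smooth_shear.
have sh : smooth (f_a_inv Omega n a) by rewrite hE; exact: smooth_shear.
split=> //; first by split=> //; exists (f_a_inv Omega n a).
by rewrite theta_aE// (Aut_pullback _ sf sh fK hK) Aut_liouville.
Qed.
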